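(* Let $n$ be a positive integer. For every constant $c>0$ there is a constant $c'>0$ depending only on $n$ and $c$ such that, for every finite chain ring $(R,\mathfrak{m})$ with residue field of cardinality $q$ and with $|R|=q^r$: if $A,B,C\subset \mathrm{M}_n(R)$ satisfy $|A||B||C| \geq c\, q^{3rn^2-\frac{n+1}{2}}$, then $|A+BC| \geq c'\, q^{rn^{2}}$. In particular, the function $f(x,y,z)=x+yz$ is a moderate expander on $\mathrm{M}_n(R)$ with exponent $\frac{n+1}{6}$.
   Context: A finite chain ring is a finite commutative ring with $1$ which is local and whose maximal ideal $\mathfrak{m}$ is principal. $\mathrm{M}_n(R)$ is the ring of $n\times n$ matrices over $R$. For $A,B,C\subset \mathrm{M}_n(R)$, $A+BC=\{a+bc: a\in A,\, b\in B,\, c\in C\}$. Moderate expander: a function $f:\mathrm{M}_n(R)^d\to \mathrm{M}_n(R)$ is a moderate expander on $\mathrm{M}_n(R)$ with exponent $\kappa(n)>0$ if there is a constant $C(n)>0$ (depending only on $n$, not on $R$, $q$ or $r$) such that for any subset $A\subset \mathrm{M}_n(R)$ with $|A| \geq C(n) q^{rn^{2}-\kappa(n)}$, one has $|f(A,\dots,A)| \geq C(n)^{-1} q^{rn^2}$, where $f(A,\dots,A)=\{f(a_1,\dots,a_d): a_1,\dots,a_d\in A\}$. *)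

(* Defs.v *)
From HB Require Import structures.
From mathcomp Require Import all_boot all_order all_algebra.
From mathcomp Require Import reals exp.

Set Implicit Arguments.
Unset Strict Implicit.
Unset Printing Implicit Defensive.

Import Order.TTheory GRing.Theory Num.Theory.
Local Open Scope ring_scope.

Section FiniteIdealQuotient.

Variables (R : finComNzRingType) (m : idealr R).

Let ideal_reprK : cancel (repr : {ideal_quot m} -> R) (\pi_{ideal_quot m})%qT.
Proof. exact: reprK. Qed.

HB.instance Definition _ := Countable.copy {ideal_quot m} (can_type ideal_reprK).
HB.instance Definition _ : isFinite {ideal_quot m} := CanIsFinite ideal_reprK.

End FiniteIdealQuotient.

(* An [idealr R] is by definition a proper ideal (it does not contain 1), so
   maximality is maximality among proper ideals. Ideals are boolean predicates,
   hence are compared extensionally. *)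
Definition maximal_ideal (R : finComNzRingType) (m : idealr R) : Prop :=
  forall I : idealr R, {subset m <= I} -> I =i m.

Definition local_ring (R : finComNzRingType) (m : idealr R) : Prop :=
  maximal_ideal m /\ forall m' : idealr R, maximal_ideal m' -> m' =i m.

Definition principal_ideal (R : finComNzRingType) (m : idealr R) : Prop :=
  exists z : R, m =i [set x * z | x : R].

Definition finite_chain_ring (R : finComNzRingType) (m : idealr R) : Prop :=
  local_ring m /\ principal_ideal m.

Definition residue_card (R : finComNzRingType) (m : idealr R) : nat :=
  #|{: {ideal_quot m}}|.

Definition addmul_set (R : finComNzRingType) (n : nat) (A B C : {set 'M[R]_n}) :
    {set 'M[R]_n} :=
  [set a + d | a in A, d in [set b *m c | b in B, c in C]].

(* The function is given uniformly in R because the constant C0 must not depend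
   on R, q or r. *)
Definition moderate_expander (K : realType) (n d : nat)
    (f : forall R : finComNzRingType, d.-tuple 'M[R]_n -> 'M[R]_n)
    (kappa : K) : Prop :=
  0 < kappa /\
  exists2 C0 : K, 0 < C0 &
    forall (R : finComNzRingType) (m : idealr R) (q r : nat),
      finite_chain_ring m -> residue_card m = q -> #|R| = (q ^ r)%N ->
      forall A : {set 'M[R]_n},
        C0 * q%:R `^ ((r * n ^ 2)%:R - kappa) <= #|A|%:R ->
        C0^-1 * q%:R `^ (r * n ^ 2)%:R
          <= #|[set f R a | a : d.-tuple 'M[R]_n & all (mem A) a]|%:R.

Definition add_mul (n : nat) (R : finComNzRingType)
    (a : 3.-tuple 'M[R]_n) : 'M[R]_n :=
  tnth a (inord 0) + tnth a (inord 1) *m tnth a (inord 2).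

(* Main.v *)
Require Import Defs.
From HB Require Import structures.
From mathcomp Require Import all_boot all_order all_algebra.
From mathcomp Require Import fingroup algC classfun character.
From mathcomp Require Import reals exp ring.

Set Implicit Arguments.
Unset Strict Implicit.
Unset Printing Implicit Defensive.

Import Order.TTheory GRing.Theory Num.Theory.
Local Open Scope ring_scope.

(** Let [M] be the ring of [n] by [n] matrices, [N = #|M|], and let [h s] be the
number of ways of writing [s = a + b * c] with [a], [b], [c] in [A], [B], [C].
The function [h] has total mass [X = |A||B||C|] and lives on [S = A + BC], so
Cauchy-Schwarz gives [X ^ 2 <= |S| * sum_s h s ^ 2], and it is enough to bound
the second moment of [h].

Parseval over the additive group of [M] ([parseval]) turns this second moment
into [N^-1] times the sum over the additive characters [chi] of
[|sum_a chi a|^2 * |sum_(b, c) chi (b * c)|^2].  The trivial character gives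
[X ^ 2].  For [chi] nontrivial, the elements [y] such that [chi] is trivial on
[M y] form a proper left ideal [J]; Cauchy-Schwarz in [b], followed by summation
over all [b] in [M], bounds the bilinear sum by [|B||C| * N * #|J|]
([bilinear_addchar_sum]).

Over a local ring with residue field of size [q], a proper left ideal of [M] has
index at least [q ^ n] ([matrix_left_ideal_index]): it misses some diagonal
matrix unit [e_ii], and matrices supported on column [i] whose entries are
distinct modulo the maximal ideal then lie in distinct cosets.

Altogether [X * N * q ^ n <= |S| * (X * q ^ n + N ^ 3)] ([sum_product_bound]),
so [|S|] is at least a constant multiple of [N] as soon as [X] is at least a
constant multiple of [N ^ 3 / q ^ n].  This implies the stated bound, because
[(n + 1) / 2 <= n].  The expander statement is the case [A = B = C], [c = 1]. *)

(** * Additive characters of a finite abelian group *)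

(** Cauchy-Schwarz against the constant function [1], by bounding each cross
term with the mean of the two squares. *)
Lemma norm_sum_sqr_le (I : finType) (P : {pred I}) (F : I -> algC) :
  `|\sum_(i in P) F i| ^+ 2 <= #|P|%:R * \sum_(i in P) `|F i| ^+ 2.
Proof.
have /le_trans: `|\sum_(i in P) F i| ^+ 2 <= (\sum_(i in P) `|F i|) ^+ 2.
  by rewrite ler_pXn2r ?nnegrE ?sumr_ge0 // ler_norm_sum.
apply.
rewrite expr2 mulr_suml.
have /le_trans: \sum_(i in P) `|F i| * (\sum_(j in P) `|F j|) <=
   \sum_(i in P) \sum_(j in P) (`|F i| ^+ 2 + `|F j| ^+ 2) / 2.
  apply: ler_sum => i _; rewrite mulr_sumr; apply: ler_sum => j _.
  exact: real_leif_mean_square (normr_real _) (normr_real _).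
apply.
under eq_bigr => i _ do rewrite -mulr_suml big_split /= sumr_const.
rewrite -mulr_suml big_split /= sumr_const sumrMnl -mulr2n -[_ *+ 2]mulr_natr.
by rewrite mulfK ?pnatr_eq0 // mulr_natl.
Qed.

Section AdditiveCharacters.

(* The additive characters are the irreducible characters of [T] viewed as a
   finite group in multiplicative notation. *)
Variable T : finZmodType.
Local Notation G := [set: T]%G.
Implicit Types (i : Iirr G) (x y : T).

Lemma addchar_lin i : 'chi_i \is a linear_char.
Proof. exact/char_abelianP/FinRing.zmod_abelian. Qed.

Lemma addcharD i x y : 'chi_i (x + y) = 'chi_i x * 'chi_i y.
Proof. by rewrite -FinRing.zmodMgE lin_charM ?addchar_lin ?inE. Qed.

Lemma addcharN i x : 'chi_i (- x) = ('chi_i x)^*.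
Proof. by rewrite -FinRing.zmodVgE lin_charV_conj ?addchar_lin ?inE. Qed.

Lemma trivial_addchar x : 'chi[G]_0 x = 1.
Proof. by rewrite irr0 cfun1E inE. Qed.

Lemma nontrivial_addchar i : i != 0 -> exists x, 'chi_i x != 1.
Proof.
move=> i_neq0; apply/existsP; apply: contraR i_neq0 => /existsPn chi1.
apply/eqP/irr_inj/cfunP => x; rewrite trivial_addchar.
by apply/eqP; rewrite -[_ == _]negbK chi1.
Qed.

Lemma addchar_orthogonality x y :
  \sum_i 'chi[G]_i x * ('chi_i y)^* = #|T|%:R *+ (x == y).
Proof.
rewrite second_orthogonality_relation ?inE //.
rewrite (setIidPl _) ?cardsT; last first.
  by apply/subsetP => z _; apply/cent1P/addrC.
congr (_ *+ nat_of_bool _); apply/imsetP/eqP => [[z _ ->] | ->].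
  by apply/conjg_fixP/commgP/addrC.
by exists 0; rewrite ?inE // conjg1.
Qed.

Lemma parseval (f : T -> algC) :
  \sum_(i : Iirr G) `|\sum_x f x * 'chi_i x| ^+ 2
    = #|T|%:R * \sum_x `|f x| ^+ 2.
Proof.
transitivity (\sum_(i : Iirr G) \sum_x \sum_y
     f x * (f y)^* * ('chi_i x * ('chi_i y)^*)).
  apply: eq_bigr => i _; rewrite normCK rmorph_sum mulr_suml.
  apply: eq_bigr => x _; rewrite mulr_sumr; apply: eq_bigr => y _.
  by rewrite rmorphM mulrACA.
rewrite exchange_big mulr_sumr; apply: eq_bigr => x _.
rewrite exchange_big (bigD1 x) //= [X in _ + X]big1 ?addr0 => [|y y_neq_x].
  by rewrite -mulr_sumr addchar_orthogonality eqxx normCK mulrC.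
by rewrite -mulr_sumr addchar_orthogonality eq_sym (negPf y_neq_x) mulr0.
Qed.

End AdditiveCharacters.

(** * Sum-product estimate in a finite ring *)

Section SumProduct.

Variables (T : finNzRingType) (d : nat).
Local Notation G := [set: T]%G.

Hypothesis left_ideal_index : forall J : {set T},
  1 \notin J -> {in J &, forall x y, x - y \in J} ->
  (forall a : T, {in J, forall x, a * x \in J}) -> (#|J| * d <= #|T|)%N.

(** The map [b |-> chi (b * y)] is itself an additive character, so its sum is
invariant under multiplication by any of its values. *)
Lemma sum_addchar_mulr (i : Iirr G) (y : T) :
  \sum_b 'chi_i (b * y) = #|T|%:R *+ [forall b : T, 'chi_i (b * y : T) == 1].
Proof.
have [/forallP triv | /forallPn[b0 /negPf b0y]] :=
  boolP [forall b : T, 'chi_i (b * y : T) == 1].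
  under eq_bigr => b _ do rewrite (eqP (triv b)).
  by rewrite sumr_const.
have /eqP : \sum_b 'chi_i (b * y) = 'chi_i (b0 * y) * \sum_b 'chi_i (b * y).
  rewrite {1}(reindex_inj (addrI b0)) mulr_sumr.
  by apply: eq_bigr => b _; rewrite mulrDl addcharD.
rewrite -subr_eq0 -{1}[\sum_b _]mul1r -mulrBl mulf_eq0 subr_eq0 eq_sym b0y /=.
by move/eqP.
Qed.

(** The cancellation comes from [J], the largest left ideal on which [chi] is
trivial: it is proper since [chi] is nontrivial, and after Cauchy-Schwarz in [b]
only the pairs [(c, c')] with [c - c'] in [J] survive. *)
Lemma bilinear_addchar_sum (i : Iirr G) (B C : {set T}) : i != 0 ->
  `|\sum_(b in B) \sum_(c in C) 'chi_i (b * c)| ^+ 2 * d%:R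
    <= #|B|%:R * #|C|%:R * #|T|%:R ^+ 2.
Proof.
move=> i_neq0; pose J := [set y : T | [forall b : T, 'chi_i (b * y : T) == 1]].
have J1 : 1 \notin J.
  have [x chix] := nontrivial_addchar i_neq0.
  by rewrite inE; apply/forallPn; exists x; rewrite mulr1.
have JB : {in J &, forall x y, x - y \in J}.
  move=> x y; rewrite !inE => /forallP x1 /forallP y1; apply/forallP => b.
  by rewrite mulrBr addcharD addcharN (eqP (x1 b)) (eqP (y1 b)) conjC1 mulr1.
have JM a : {in J, forall x, a * x \in J}.
  move=> x; rewrite !inE => /forallP x1; apply/forallP => b.
  by rewrite mulrA x1.
have index_J := left_ideal_index J1 JB JM.
have second_moment : \sum_b `|\sum_(c in C) 'chi_i (b * c)| ^+ 2
    <= #|C|%:R * (#|T| * #|J|)%:R.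
  have -> : \sum_b `|\sum_(c in C) 'chi_i (b * c)| ^+ 2 =
      \sum_(c in C) \sum_(c' in C) #|T|%:R *+ (c - c' \in J).
    transitivity (\sum_b \sum_(c in C) \sum_(c' in C) 'chi_i (b * (c - c'))).
      apply: eq_bigr => b _; rewrite normCK rmorph_sum mulr_suml.
      apply: eq_bigr => c _; rewrite mulr_sumr; apply: eq_bigr => c' _.
      by rewrite mulrBr addcharD addcharN.
    rewrite exchange_big; apply: eq_bigr => c _.
    rewrite exchange_big; apply: eq_bigr => c' _.
    by rewrite sum_addchar_mulr inE.
  rewrite -sum1_card natr_sum mulr_suml; apply: ler_sum => c _.
  rewrite mul1r sumrMnr natrM mulr_natr ler_wpMn2l //.
  have <- : (\sum_(c' in C | (c - c')%R \in J) 1 =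
             \sum_(c' in C) ((c - c')%R \in J))%N.
    by rewrite big_mkcondr; apply: eq_bigr => c' _; case: (_ \in J).
  (* for fixed [c], the elements [c'] of [C] that count lie in [c - J] *)
  rewrite -(card_preimset J (can_inj (subKr c))) sum1_card.
  by apply/subset_leq_card/subsetP => c' /andP[_ c'J]; rewrite inE.
(* positivity lets the outer sum be extended from [B] to the whole ring *)
apply: le_trans (_ : #|B|%:R * (#|C|%:R * (#|T| * #|J|)%:R) * d%:R <= _).
  rewrite ler_wpM2r //; apply: le_trans (norm_sum_sqr_le _ _) _.
  rewrite ler_wpM2l //; apply: le_trans second_moment.
  rewrite [leRHS](bigID (mem B)) /= lerDl.
  by rewrite sumr_ge0 // => b _; rewrite exprn_ge0.
rewrite -!mulrA !ler_wpM2l // -natrX -natrM ler_nat -mulnA -mulnn.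
by rewrite leq_mul2l index_J orbT.
Qed.

(** Second-moment method for the number [h s] of representations of [s] as
[a + b * c]: its Fourier transform is that of [A] times a bilinear sum, the
trivial character contributes the main term, and for all the others the bilinear
sum is bounded by [bilinear_addchar_sum]. *)
Theorem sum_product_bound (A B C S : {set T}) :
  {in A & B & C, forall a b c, a + b * c \in S} ->
  (#|A| * #|B| * #|C| * (#|T| * d) <=
     #|S| * (#|A| * #|B| * #|C| * d + #|T| ^ 3))%N.
Proof.
move=> ABC_S; set X := (#|A| * #|B| * #|C|)%N.
pose h s : algC :=
  \sum_(a in A) \sum_(b in B) \sum_(c in C) (a + b * c == s)%:R.
pose hatA (i : Iirr G) := \sum_(a in A) 'chi_i a.
pose hatBC (i : Iirr G) := \sum_(b in B) \sum_(c in C) 'chi_i (b * c).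
have h_sum (f : T -> algC) :
    \sum_s h s * f s = \sum_(a in A) \sum_(b in B) \sum_(c in C) f (a + b * c).
  under eq_bigr => s _ do rewrite mulr_suml.
  rewrite exchange_big; apply: eq_bigr => a _.
  under eq_bigr => s _ do rewrite mulr_suml.
  rewrite exchange_big; apply: eq_bigr => b _.
  under eq_bigr => s _ do rewrite mulr_suml.
  rewrite exchange_big; apply: eq_bigr => c _.
  rewrite (bigD1 (a + b * c)) //= eqxx mul1r big1 ?addr0 // => s.
  by rewrite eq_sym => /negPf ->; rewrite mul0r.
have card_triples : \sum_(a in A) \sum_(b in B) \sum_(c in C) 1 = X%:R :> algC.
  by rewrite !sumr_const -!mulrnA mulnC [(#|B| * _)%N]mulnC.
have mass_h : \sum_(s in S) h s = X%:R.
  rewrite -card_triples -(h_sum (fun=> 1)) big_mkcond; apply: eq_bigr => s _.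
  rewrite mulr1; case: ifP => // /negP sS; apply/esym.
  rewrite /h big1 // => a aA; rewrite big1 // => b bB; rewrite big1 // => c cC.
  by case: eqP => // abc; case: sS; rewrite -abc ABC_S.
have hat_h i : \sum_s h s * 'chi_i s = hatA i * hatBC i.
  rewrite h_sum mulr_suml; apply: eq_bigr => a _; rewrite mulr_sumr.
  apply: eq_bigr => b _; rewrite mulr_sumr; apply: eq_bigr => c _.
  exact: addcharD.
have energy_A : \sum_i `|hatA i| ^+ 2 = (#|T| * #|A|)%:R.
  transitivity (#|T|%:R * \sum_x `|(x \in A)%:R : algC| ^+ 2).
    rewrite -parseval; apply: eq_bigr => i _; congr (`|_| ^+ 2).
    rewrite /hatA big_mkcond; apply: eq_bigr => a _.
    by case: (a \in A); rewrite ?mul1r ?mul0r.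
  rewrite natrM -[#|A|]sum1_card natr_sum [in RHS]big_mkcond.
  congr (_ * _); apply: eq_bigr => a _.
  by case: (a \in A); rewrite ?normr1 ?normr0 ?expr1n ?expr0n.
have energy_h : (\sum_s `|h s| ^+ 2) * (#|T| * d)%:R
    <= (X * (X * d + #|T| ^ 3))%:R.
  rewrite natrM mulrA [_ * #|T|%:R]mulrC -parseval.
  (* the trivial character accounts for [X ^ 2] *)
  rewrite (bigD1 (0 : Iirr G)) //= hat_h mulrDl.
  have -> : hatA 0 * hatBC 0 = X%:R.
    rewrite -hat_h -card_triples -(h_sum (fun=> 1)).
    by apply: eq_bigr => s _; rewrite trivial_addchar.
  rewrite mulnDr natrD normr_nat -natrX -natrM -mulnn -mulnA lerD //.
  (* the bilinear bound is uniform in [i], so Parseval for [A] finishes *)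
  rewrite mulr_suml.
  apply: le_trans (_ : \sum_i
      `|hatA i| ^+ 2 * (#|B| * #|C| * #|T| ^ 2)%:R <= _).
    rewrite [leRHS](bigD1 (0 : Iirr G)) //= ler_wpDl ?mulr_ge0 ?exprn_ge0 //.
    apply: ler_sum => i i_neq0; rewrite hat_h normrM exprMn -mulrA ler_wpM2l //.
      exact: exprn_ge0.
    by rewrite natrM natrX natrM bilinear_addchar_sum.
  rewrite -mulr_suml energy_A -natrM ler_nat /X; apply/eq_leq.
  by rewrite expnS !mulnA -![(_ * #|T|)%N]mulnC !mulnA.
have [-> // | X_gt0] := posnP X.
rewrite -(leq_pmul2l X_gt0) [leqRHS]mulnCA -(ler_nat algC) [leRHS]natrM.
apply: le_trans (ler_wpM2l (ler0n _ #|S|) energy_h).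
rewrite mulnA natrM [leRHS]mulrA ler_wpM2r //.
rewrite natrM -mass_h -expr2.
have -> : \sum_(s in S) h s = `|\sum_(s in S) h s| by rewrite mass_h normr_nat.
apply: le_trans (norm_sum_sqr_le _ _) _; rewrite ler_wpM2l //.
rewrite [leRHS](bigID (mem S)) /= lerDl.
by rewrite sumr_ge0 // => s _; rewrite exprn_ge0.
Qed.

End SumProduct.

(** * Left ideals of matrices over a local ring *)

Section LocalRing.

Variables (R : finComNzRingType) (m : idealr R).

(** Boolean form of [idealr_closed], so that a maximal ideal can be found among
the finitely many subsets of [R]. *)
Definition is_ideal (J : {set R}) :=
  [&& 0 \in J, 1 \notin J &
      [forall a, forall u in J, forall v in J, a * u + v \in J]].

Lemma is_idealP (J : {set R}) : reflect (idealr_closed J) (is_ideal J).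
Proof.
apply: (iffP and3P) => -[J0 J1 JD]; split => //.
  move=> a u v uJ vJ.
  by have /forallP/(_ a)/forall_inP/(_ u uJ)/forall_inP/(_ v vJ) := JD.
apply/forallP => a; apply/forall_inP => u uJ; apply/forall_inP => v.
exact: JD.
Qed.

Lemma idealr_of_closed (J : {set R}) :
  idealr_closed J -> {I : idealr R | I =i J}.
Proof.
move=> J_closed.
pose P : R -> bool := fun x => x \in J.
have P_closed : idealr_closed P by [].
pose I : idealr R := HB.pack P (isIdealr.Build R P P_closed).
by exists I.
Qed.

(** A proper ideal of largest possible size above [J] is a maximal ideal, and
[m] is the only one. *)
Lemma local_ring_proper_ideal_sub (J : {set R}) : local_ring m ->
  idealr_closed J -> {subset J <= m}.
Proof.
move=> [_ m_unique] /is_idealP /maxset_exists[I0].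
move=> /maxsetP[/is_idealP I0_ideal maxI0] /subsetP sub_J_I0.
have [I I_I0] := idealr_of_closed I0_ideal.
suffices /m_unique Im : maximal_ideal I.
  by move=> x /sub_J_I0; rewrite -I_I0 Im.
move=> I' sub_I_I'.
suffices eq_I0 : [set x | x \in I'] = I0 by move=> x; rewrite I_I0 -eq_I0 inE.
apply: maxI0; last by apply/subsetP => x; rewrite -I_I0 inE; exact: sub_I_I'.
apply/is_idealP; split; rewrite ?inE ?rpred0 ?idealr1 // => a u v.
by rewrite !inE => uI' vI'; rewrite rpredD // idealMr.
Qed.

(** Since the sum of the [e_ii] is [1], some [e_ii] is not in [J], and the
scalars [t] with [t e_ii] in [J] form a proper ideal, contained in [m].  Lift
each vector over the residue field to a matrix supported on column [i]:
multiplying the difference of two lifts by [e_ik] isolates its entry [k] as a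
multiple of [e_ii], so lifts of distinct vectors are distinct modulo [J]. *)
Lemma matrix_left_ideal_index n (J : {set 'M[R]_n.+1}) : local_ring m ->
  1 \notin J -> {in J &, forall x y, x - y \in J} ->
  (forall a : 'M[R]_n.+1, {in J, forall x, a * x \in J}) ->
  (#|J| * residue_card m ^ n.+1 <= #|{: 'M[R]_n.+1}|)%N.
Proof.
move=> m_local J1 JB JM.
have [-> | [x0 x0J]] := set_0Vmem J; first by rewrite cards0.
have J0 : 0 \in J by rewrite -(subrr x0) JB.
have JN x : x \in J -> - x \in J by move=> xJ; rewrite -sub0r JB.
have JD x y : x \in J -> y \in J -> x + y \in J.
  by move=> xJ yJ; rewrite -[y]opprK JB // JN.
have [i Ji] : exists i, delta_mx i i \notin J.
  apply/existsP; apply: contraR J1 => /existsPn Jdelta.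
  rewrite -[1]/(1%:M) mx1_sum_delta.
  by elim/big_ind: _ => // k _; have := Jdelta k; rewrite negbK.
have entry_ideal t : t *: delta_mx i i \in J -> t \in m.
  move=> tJ.
  apply: (local_ring_proper_ideal_sub (J := [set t | t *: delta_mx i i \in J]));
    rewrite ?inE //.
  split; rewrite ?inE ?scale0r ?scale1r // => a u v; rewrite !inE => uJ vJ.
  rewrite scalerDl JD // -scalerA -mul_scalar_mx; exact: JM.
pose f (p : 'M[R]_n.+1 * {ffun 'I_n.+1 -> {ideal_quot m}}) : 'M[R]_n.+1 :=
  p.1 + \matrix_(k, l) (generic_quotient.repr (p.2 k) *+ (l == i)).
have f_inj : {in setX J setT &, injective f}.
  move=> [x v] [y w]; rewrite !inE !andbT /= => xJ yJ; rewrite /f /= => fxy.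
  suffices eq_vw : v = w by move: fxy; rewrite eq_vw => /addIr ->.
  apply/ffunP => k; rewrite -[v k]reprK -[w k]reprK; apply/eqP.
  rewrite -Quotient.idealrBE; apply: entry_ideal.
  (* [e_ik] moves entry [k] of the difference of the lifts to place [(i, i)] *)
  have -> : (generic_quotient.repr (v k) - generic_quotient.repr (w k))
              *: delta_mx i i = delta_mx i k * (y - x).
    have -> : y - x = \matrix_(k, l) (generic_quotient.repr (v k) *+ (l == i)) -
                      \matrix_(k, l) (generic_quotient.repr (w k) *+ (l == i)).
      apply/eqP; rewrite subr_eq addrAC -subr_eq opprK; apply/eqP.
      by rewrite -fxy addrC.
    apply/matrixP => a b; rewrite !mxE (bigD1 k) //= big1 => [|j /negPf jk].
      rewrite !mxE eqxx andbT addr0.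
      case: (a == i); case: (b == i);
        by rewrite ?mulr1 ?mul1r ?mulr0 ?mul0r ?subrr.
    by rewrite mxE jk andbF mul0r.
  by apply/JM/JB.
have <- : #|[set f p | p in setX J setT]| = (#|J| * residue_card m ^ n.+1)%N.
  by rewrite card_in_imset // cardsX cardsT card_ffun card_ord.
exact: max_card.
Qed.

End LocalRing.

(** * Expansion of A + BC *)

Lemma addmul_set_lower_bound (R : finComNzRingType) (m : idealr R) n
    (A B C : {set 'M[R]_n}) : (0 < n)%N -> local_ring m ->
  (#|A| * #|B| * #|C| * (#|{: 'M[R]_n}| * residue_card m ^ n) <=
     #|addmul_set A B C| *
       (#|A| * #|B| * #|C| * residue_card m ^ n + #|{: 'M[R]_n}| ^ 3))%N.
Proof.
case: n => // n in A B C * => _ m_local.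
apply: sum_product_bound => [J|a b c aA bB cC].
  exact: matrix_left_ideal_index.
by apply/imset2P; exists a (b *m c) => //; apply: imset2_f.
Qed.

Lemma residue_card_gt0 (R : finComNzRingType) (m : idealr R) :
  (0 < residue_card m)%N.
Proof. by apply/card_gt0P; exists (\pi_{ideal_quot m} 0)%qT. Qed.

(** With [N = q ^ (r n ^ 2)] and [X = |A||B||C|], the hypothesis gives
[c N ^ 3 <= X q ^ n] because [(n + 1) / 2 <= n]; then [N ^ 3] is at most [c^-1]
times [X q ^ n], and dividing [addmul_set_lower_bound] by [X q ^ n] gives
[N <= |S| (1 + c^-1)], where [S = A + BC]. *)
Lemma addmul_set_expansion (K : realType) (n : nat) (c : K)
    (R : finComNzRingType) (m : idealr R) (q r : nat) (A B C : {set 'M[R]_n}) :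
  (0 < n)%N -> 0 < c ->
  local_ring m -> residue_card m = q -> #|R| = (q ^ r)%N ->
  c * q%:R `^ ((3 * r * n ^ 2)%:R - (n.+1)%:R / 2%:R)
    <= #|A|%:R * #|B|%:R * #|C|%:R ->
  c / (1 + c) * q%:R `^ (r * n ^ 2)%:R <= #|addmul_set A B C|%:R.
Proof.
move=> n_gt0 c_gt0 m_local card_q card_R ABC_large.
have := addmul_set_lower_bound A B C n_gt0 m_local.
have q_gt0 : (0 < q)%N by rewrite -card_q residue_card_gt0.
rewrite card_q card_mx card_R -expnM mulnn.
rewrite -!natrM in ABC_large.
set X := (#|A| * #|B| * #|C|)%N in ABC_large *; set S := #|addmul_set A B C|.
rewrite powR_mulrn // -natrX; set N := (q ^ (r * n ^ 2))%N => bound.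
have N_gt0 : 0 < N%:R :> K by rewrite ltr0n expn_gt0 q_gt0.
have Xd_large : c * N%:R ^+ 3 <= (X * q ^ n)%:R.
  have -> : N%:R ^+ 3 = q%:R `^ ((3 * r * n ^ 2)%:R - (n.+1)%:R / 2%:R)
                      * q%:R `^ (n.+1%:R / 2%:R) :> K.
    rewrite -powRD ?pnatr_eq0 -?lt0n ?q_gt0 ?implybT // subrK.
    by rewrite powR_mulrn // -!natrX -expnM mulnC mulnA.
  rewrite mulrA [leRHS]natrM ler_pM ?mulr_ge0 ?powR_ge0 ?(ltW c_gt0) //.
  rewrite natrX -powR_mulrn // ler_powR ?ler1n //.
  by rewrite ler_pdivrMr // -natrM ler_nat muln2 -addnn -addn1 leq_add2l.
have Xd_gt0 : 0 < (X * q ^ n)%:R :> K.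
  by apply: lt_le_trans Xd_large; rewrite mulr_gt0 ?exprn_gt0.
rewrite mulrAC ler_pdivrMr ?addr_gt0 // -(ler_pM2r Xd_gt0).
apply: le_trans (_ : c * (S * (X * q ^ n + N ^ 3))%:R <= _).
  by rewrite -mulrA -natrM ler_pM2l // ler_nat mulnCA.
rewrite natrM natrD natrX mulrCA -[leRHS]mulrA ler_wpM2l //.
by rewrite mulrDr mulrDl mul1r addrC lerD2r.
Qed.

Lemma addmul_set_sub_add_mul (R : finComNzRingType) n (A : {set 'M[R]_n}) :
  addmul_set A A A \subset
    [set add_mul a | a : 3.-tuple 'M[R]_n & all (mem A) a].
Proof.
apply/subsetP => _ /imset2P[a _ aA /imset2P[b c bA cA ->] ->].
apply/imsetP; exists [tuple a; b; c]; first by rewrite inE /= aA bA cA.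
by rewrite /add_mul !(tnth_nth 0) !inordK.
Qed.

Theorem corollary1p15 (K : realType) (n : nat) (n_gt0 : (0 < n)%N) :
  (forall c : K, 0 < c ->
     exists2 c' : K, 0 < c' &
       forall (R : finComNzRingType) (m : idealr R) (q r : nat),
         finite_chain_ring m -> residue_card m = q -> #|R| = (q ^ r)%N ->
         forall A B C : {set 'M[R]_n},
           c * q%:R `^ ((3 * r * n ^ 2)%:R - (n.+1)%:R / 2%:R)
             <= #|A|%:R * #|B|%:R * #|C|%:R ->
           c' * q%:R `^ (r * n ^ 2)%:R <= #|addmul_set A B C|%:R)
  /\ moderate_expander (@add_mul n) ((n.+1)%:R / 6%:R : K).
Proof.
split=> [c c_gt0|].
  exists (c / (1 + c)); first by rewrite divr_gt0 ?addr_gt0.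
  move=> R m q r [m_local _] card_q card_R A B C.
  exact: addmul_set_expansion m_local card_q card_R.
split; first by rewrite divr_gt0.
(* the first part with [c = 1] has constant [c / (1 + c) = 1 / 2], which must be
   the inverse of the constant chosen here; as [2 ^ 3 >= 1], [c = 1] applies *)
exists 2 => // R m q r [m_local _] card_q card_R A A_large.
apply: le_trans (_ : #|addmul_set A A A|%:R <= _); last first.
  by rewrite ler_nat subset_leq_card // addmul_set_sub_add_mul.
have -> : 2^-1 = 1 / (1 + 1) :> K by rewrite div1r.
apply: addmul_set_expansion m_local card_q card_R _ => //; rewrite mul1r.
set t := (r * n ^ 2)%:R - _ in A_large.
have -> : (3 * r * n ^ 2)%:R - n.+1%:R / 2%:R = t * 3%:R :> K.
  by rewrite /t -mulnA natrM; field.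
rewrite powRrM powR_mulrn ?powR_ge0 // -!expr2 -exprSr.
rewrite ler_pXn2r ?nnegrE ?powR_ge0 //; apply: le_trans A_large.
by rewrite ler_peMl ?powR_ge0 // ler1n.
Qed.
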